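(* Let $k>0$. For $N\in\mathbb{N}^+$ and $h=\frac1{N+1}$, let $\mathcal{A}_h$ be the matrix defined below and $T_h(t)=e^{\mathcal{A}_ht}$ the semigroup it generates on $\mathbb{Y}_h=(\mathbb{C}^{N+1},\langle\cdot,\cdot\rangle_{\mathbb{Y}_h})$. Then the family $\{T_h(t)\}$ is uniformly exponentially stable: there exist constants $M>0$ and $\omega>0$ independent of $h$ such that $$\|T_h(t)\|\le Me^{-\omega t}\quad\text{for all }t\ge0\text{ and all such }h\in(0,1),$$ where $\|\cdot\|$ is the operator norm induced by $\langle\cdot,\cdot\rangle_{\mathbb{Y}_h}$.
   Context: Let $D_h$ be the $(N+1)\times(N+1)$ lower bidiagonal matrix with $\frac12$ on the diagonal and first subdiagonal, and $M_h$ the $(N+1)\times(N+1)$ upper bidiagonal matrix with $-\frac1h$ on the diagonal and $\frac1h$ on the first superdiagonal; $e_{N+1}=(0,\dots,0,1)^\top$. For $Y_h=(y_1,\dots,y_{N+1})^\top\in\mathbb{C}^{N+1}$ let $Z_h$ solve $D_h^\top Z_h=-M_h^\top Y_h+\tfrac{ik}2y_{N+1}e_{N+1}$ and set $\mathcal{A}_hY_h=D_h^{-1}[-iM_hZ_h-\tfrac kh y_{N+1}e_{N+1}]$. This is the order-reduction semi-discretization of the Schrödinger system $w_t=-iw_{xx}$, $w(0,t)=0$, $w_x(1,t)=-ikw(1,t)$ on $[0,1]$ with mesh size $h$. The inner product on $\mathbb{Y}_h=\mathbb{C}^{N+1}$ is $\langle Y_h,\widetilde Y_h\rangle_{\mathbb{Y}_h}=h\langle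 D_hY_h,D_h\widetilde Y_h\rangle$, with $\langle\cdot,\cdot\rangle$ the standard inner product of $\mathbb{C}^{N+1}$. *)

(* Defs.v *)
(* MathComp + MathComp-Analysis, complex numbers R[i] from
   mathcomp-real-closed (complex.v), over an abstract R : realType. *)
From mathcomp Require Import all_boot all_order all_algebra.
From mathcomp Require Import complex.
From mathcomp Require Import all_classical all_reals all_analysis.
Import numFieldTopology.Exports numFieldNormedType.Exports.
Import GRing.Theory Num.Theory.

Set Implicit Arguments.
Unset Strict Implicit.
Unset Printing Implicit Defensive.

Local Open Scope ring_scope.
Local Open Scope complex_scope.
Local Open Scope classical_set_scope.

(* Matrix exponential e^{tA} = sum_k t^k/k! A^k, defined entrywise as the
   limit of the partial sums (in C = R[i] with its norm topology). *)
Definition mxexp (R : realType) (n : nat) (A : 'M[R[i]]_n.+1) (t : R)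
  : 'M[R[i]]_n.+1 :=
  \matrix_(i, j)
    lim ((fun m : nat =>
            ((\sum_(l < m) ((t ^+ l / (l`!)%:R)%:C *: A ^+ l)) i j : R[i]^o))
         @ \oo).

(* mesh size h = 1/(N+1); the matrices have size N+1 *)
Definition hN (R : realType) (N : nat) : R := (N.+1%:R)^-1.

(* D_h : lower bidiagonal, 1/2 on the diagonal and first subdiagonal *)
Definition Dh (R : realType) (N : nat) : 'M[R[i]]_N.+1 :=
  \matrix_(i, j)
    (if (i == j) || (nat_of_ord i == (nat_of_ord j).+1) then (2^-1 : R)%:C
     else 0).

(* M_h : upper bidiagonal, -1/h on the diagonal, 1/h on the first superdiagonal *)
Definition Mh (R : realType) (N : nat) : 'M[R[i]]_N.+1 :=
  \matrix_(i, j)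
    (if i == j then (- (hN R N)^-1)%:C
     else if nat_of_ord j == (nat_of_ord i).+1 then ((hN R N)^-1)%:C
     else 0).

(* E = e_{N+1} e_{N+1}^T, so that E Y = y_{N+1} e_{N+1} *)
Definition Eh (R : realType) (N : nat) : 'M[R[i]]_N.+1 :=
  delta_mx ord_max ord_max.

(* A_h Y = D_h^{-1} [ -i M_h Z_h - (k/h) y_{N+1} e_{N+1} ],
   with Z_h = (D_h^T)^{-1} ( -M_h^T Y + (i k / 2) y_{N+1} e_{N+1} ). *)
Definition Ah (R : realType) (k : R) (N : nat) : 'M[R[i]]_N.+1 :=
  invmx (Dh R N) *m
    ((- 'i) *: (Mh R N *m (invmx (Dh R N)^T *m
        (- (Mh R N)^T + ('i * (k / 2)%:C) *: Eh R N)))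
     - (k / hN R N)%:C *: Eh R N).

(* <Y, Y~>_{Y_h} = h <D_h Y, D_h Y~>, standard inner product of C^{N+1}
   (linear in the first argument, conjugate-linear in the second). *)
Definition yinner (R : realType) (N : nat) (Y Z : 'cV[R[i]]_N.+1) : R[i] :=
  (hN R N)%:C * \sum_(i < N.+1) ((Dh R N *m Y) i 0 * ((Dh R N *m Z) i 0)^*).

Arguments yinner {R} N Y Z.

Definition ynorm (R : realType) (N : nat) (Y : 'cV[R[i]]_N.+1) : R :=
  Num.sqrt (complex.Re (yinner N Y Y)).

Arguments ynorm {R} N Y.

(* Main.v *)
(** Put [n = N + 1] and [h = 1 / n].  On the nodes [0, ..., n], with [y_0 = 0]
    and [z_n = - i k y_n], the scheme reads: average of [y'] = [- i] times the
    difference quotient of [z], average of [z] = difference quotient of [y].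
    With [e] the average of [y], the energy [E = h sum |e|^2] satisfies
    [E' = - 2 k |y_n|^2].

    The energy is made coercive by a multiplier one order below it.  Let [Q] be
    the discrete primitive of [e] with [Q_n = 0]; its evolution
    [Q' = k y_n - i z] is driven only by the dissipated quantity [y_n].  The
    functional [F = h sum x Im(avg Q conj e)] is bounded by [E], and summation
    by parts gives [F' >= E - (1 + 5/2 k^2) |y_n|^2], where the discretization
    error has a favourable sign.  Hence [E - eps F] is a Lyapunov function with
    a decay rate independent of [h]. *)
Require Import Defs.
From mathcomp Require Import all_boot all_order all_algebra.
From mathcomp Require Import complex.
From mathcomp Require Import all_classical all_reals all_analysis.
From mathcomp Require Import ring lra.
Import numFieldTopology.Exports numFieldNormedType.Exports.
Import Order.TTheory GRing.Theory Num.Theory.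

Set Implicit Arguments.
Unset Strict Implicit.
Unset Printing Implicit Defensive.

Local Open Scope ring_scope.
Local Open Scope complex_scope.

(** * Matrix exponential *)

Section ExpSeries.
Variable R : realType.
Implicit Types (a : nat -> R) (C r x t : R).

Lemma cvg_pseries_fact a C r x : (forall l, `|a l| <= C * r ^+ l) ->
  cvgn (pseries (fun l => a l / l`!%:R) x).
Proof.
move=> ale; apply: normed_cvg.
have C0 l : 0 <= C * r ^+ l by rewrite (le_trans _ (ale l)).
apply: (@series_le_cvg _ _ (fun l => C * exp_coeff (`|r * x|) l)) => [l|l|l|].
- by rewrite /= normr_ge0.
- by apply: mulr_ge0; rewrite ?exp_coeff_ge0//; have := C0 0%N;
    rewrite expr0 mulr1.
- rewrite /= 2!normrM normfV [`|_%:R|]ger0_norm// /exp_coeff /=.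
  rewrite mulrAC [leRHS]mulrA ler_wpM2r ?invr_ge0// normrM exprMn mulrA normrX.
  rewrite ler_wpM2r ?exprn_ge0// (le_trans (ale l))// -normrX.
  rewrite ler_wpM2l ?ler_norm//.
  by have := C0 0%N; rewrite expr0 mulr1.
- apply: is_cvg_seriesZ.
  exact: is_cvg_series_exp_coeff.
Qed.

(** Termwise differentiation turns [a l / l!] into [a l.+1 / l!], and the shifted sequence keeps a
    geometric bound, with [C * r] for [C]. The series and its first two formal derivatives therefore
    converge everywhere. *)
Lemma is_derive_pseries_fact a C r x : (forall l, `|a l| <= C * r ^+ l) ->
  is_derive x 1 (fun t => limn (pseries (fun l => a l / l`!%:R) t))
    (limn (pseries (fun l => a l.+1 / l`!%:R) x)).
Proof.
have dE b : pseries_diffs (fun l => b l / l`!%:R : R) =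
    (fun l => b l.+1 / l`!%:R).
  apply/funext => l; rewrite /pseries_diffs factS natrM; field.
  by rewrite nat1r !pnatr_eq0 -lt0n fact_gt0.
have shift (b : nat -> R) D : (forall l, `|b l| <= D * r ^+ l) ->
    forall l, `|b l.+1| <= (D * r) * r ^+ l.
  by move=> H l; rewrite -mulrA -exprS.
move=> ale; have ale1 := shift a _ ale.
have ale2 := shift (fun l => a l.+1) _ ale1.
rewrite -dE.
apply: (@pseries_snd_diffs _ _ (`|x| + 1)); last first.
- by rewrite [ltRHS]ger0_norm ?addr_ge0// ltrDl.
- rewrite dE (dE (fun l => a l.+1)); exact: cvg_pseries_fact ale2.
- rewrite dE; exact: cvg_pseries_fact ale1.
- exact: cvg_pseries_fact ale.
Qed.

End ExpSeries.

(** * Complex limits through real and imaginary parts *)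

Section ComplexParts.
Local Open Scope classical_set_scope.
Variable R : realType.
Local Notation C := R[i].

Lemma cvg_complex (u : nat -> C) (a b : R) :
  (fun n => complex.Re (u n)) @ \oo --> a ->
  (fun n => complex.Im (u n)) @ \oo --> b ->
  (u : nat -> C^o) @ \oo --> (a +i* b : C^o).
Proof.
move=> ua ub; apply/cvgrPdist_lt => e e0.
(* The radius [e] is complex; positivity in the order of [C] makes it real. *)
have [eI eR] : complex.Im e = 0 /\ 0 < complex.Re e.
  by move: e0; rewrite ltcE /= => /andP[/eqP].
have e2 : 0 < complex.Re e / 2 by rewrite divr_gt0.
move/cvgrPdist_lt : ua => /(_ _ e2) ua; move/cvgrPdist_lt : ub => /(_ _ e2) ub.
near=> n.
have an : `|a - complex.Re (u n)| < complex.Re e / 2 by near: n.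
have bn : `|b - complex.Im (u n)| < complex.Re e / 2 by near: n.
rewrite (complexE e) eI mulr0 addr0 normc_def ltcR /=.
case: (u n) an bn => c d /= an bn.
apply: (@le_lt_trans _ _ (`|a - c| + `|b - d|)); last by lra.
rewrite -[leRHS]ger0_norm ?addr_ge0// -sqrtr_sqr ler_wsqrtr//.
rewrite -(real_normK (num_real (a - c))) -(real_normK (num_real (b - d))).
by rewrite sqrrD -addrA lerD2l lerDr mulrn_wge0// mulr_ge0.
Unshelve. all: by end_near.
Qed.

Lemma lim_complex (u : nat -> C) (a b : R) :
  (fun n => complex.Re (u n)) @ \oo --> a ->
  (fun n => complex.Im (u n)) @ \oo --> b ->
  lim ((u : nat -> C^o) @ \oo) = a +i* b.
Proof.
move=> ua ub; apply: cvg_lim; last exact: cvg_complex.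
exact: norm_hausdorff.
Qed.

End ComplexParts.

(** * Derivatives of complex functions of a real variable *)

Section ComplexDerive.
Variable R : realType.
Local Notation C := R[i].
Local Notation Re := complex.Re.
Local Notation Im := complex.Im.

Lemma complex_ReM (x y : C) : Re (x * y) = Re x * Re y - Im x * Im y.
Proof. by case: x y => [a b] [c d]. Qed.

Lemma complex_ImM (x y : C) : Im (x * y) = Re x * Im y + Im x * Re y.
Proof. by case: x y => [a b] [c d]. Qed.

Lemma complex_ReD (x y : C) : Re (x + y) = Re x + Re y.
Proof. by case: x y => [a b] [c d]. Qed.

Lemma complex_ImD (x y : C) : Im (x + y) = Im x + Im y.
Proof. by case: x y => [a b] [c d]. Qed.

Lemma complex_ReJ (x : C) : Re x^* = Re x.
Proof. by case: x. Qed.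

Lemma complex_ImJ (x : C) : Im x^* = - Im x.
Proof. by case: x. Qed.

Lemma complex_Re_sum I (r : seq I) (P : pred I) (F : I -> C) :
  Re (\sum_(i <- r | P i) F i) = \sum_(i <- r | P i) Re (F i).
Proof. by apply: big_morph; [exact: complex_ReD | ]. Qed.

Lemma complex_Im_sum I (r : seq I) (P : pred I) (F : I -> C) :
  Im (\sum_(i <- r | P i) F i) = \sum_(i <- r | P i) Im (F i).
Proof. by apply: big_morph; [exact: complex_ImD | ]. Qed.

Definition is_cderive (t : R) (f : R -> C) (d : C) :=
  is_derive t 1 (fun s => Re (f s)) (Re d) /\
  is_derive t 1 (fun s => Im (f s)) (Im d).

Lemma is_cderiveMl t c f d : is_cderive t f d ->
  is_cderive t (fun s => c * f s) (c * d).
Proof.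
move=> [fR fI]; split.
  under eq_fun do rewrite complex_ReM; rewrite complex_ReM.
  by apply: is_derive_eq; rewrite /GRing.scale /=; ring.
under eq_fun do rewrite complex_ImM; rewrite complex_ImM.
by apply: is_derive_eq; rewrite /GRing.scale /=; ring.
Qed.

Lemma is_cderiveJ t f d : is_cderive t f d ->
  is_cderive t (fun s => (f s)^*) d^*.
Proof.
move=> [fR fI]; split.
  by under eq_fun do rewrite complex_ReJ; rewrite complex_ReJ.
by under eq_fun do rewrite complex_ImJ; rewrite complex_ImJ; exact: is_deriveN.
Qed.

Lemma is_cderiveM t f g d e : is_cderive t f d -> is_cderive t g e ->
  is_cderive t (fun s => f s * g s) (d * g t + f t * e).
Proof.
move=> [fR fI] [gR gI]; split.
  under eq_fun do rewrite complex_ReM.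
  apply: is_derive_eq; rewrite complex_ReD !complex_ReM /GRing.scale /=; ring.
under eq_fun do rewrite complex_ImM.
apply: is_derive_eq; rewrite complex_ImD !complex_ImM /GRing.scale /=; ring.
Qed.

Lemma is_cderive_sum t n (f : 'I_n -> R -> C) (d : 'I_n -> C) :
  (forall i, is_cderive t (f i) (d i)) ->
  is_cderive t (fun s => \sum_(i < n) f i s) (\sum_(i < n) d i).
Proof.
move=> fd; split.
  rewrite (_ : (fun s => _) = \sum_(i < n) (fun s => Re (f i s))); last first.
    by apply/funext => s; rewrite complex_Re_sum fct_sumE.
  rewrite complex_Re_sum.
  by apply: is_derive_sum => i; case: (fd i).
rewrite (_ : (fun s => _) = \sum_(i < n) (fun s => Im (f i s))); last first.
  by apply/funext => s; rewrite complex_Im_sum fct_sumE.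
rewrite complex_Im_sum.
by apply: is_derive_sum => i; case: (fd i).
Qed.

End ComplexDerive.

(** * Entrywise calculus of the matrix exponential *)

Section MatrixExponential.
Variables (R : realType) (n : nat).
Local Open Scope classical_set_scope.
Local Notation C := R[i].
Local Notation Re := complex.Re.
Local Notation Im := complex.Im.
Implicit Types (A B : 'M[C]_n.+1) (t : R).

(** The sum [r] of the moduli of all entries dominates every row sum, so each multiplication by [A]
    costs at most a factor [r]. The factor [1] matches the shape [C * r ^+ l] of the power series
    lemmas. *)
Lemma mxpow_bound A : exists r : R, forall l i j,
  `|Re ((A ^+ l) i j)| <= 1 * r ^+ l /\ `|Im ((A ^+ l) i j)| <= 1 * r ^+ l.
Proof.
pose r : C := \sum_i \sum_j `|A i j|.
have r0 : 0 <= r by apply: sumr_ge0 => i _; apply: sumr_ge0.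
have Ar l : forall i j, `|(A ^+ l) i j| <= r ^+ l.
  elim: l => [i j|l IH i j].
    by rewrite expr0 mxE; case: eqP => _; rewrite ?normr1 ?normr0 ?ler01.
  rewrite !exprS mxE (le_trans (ler_norm_sum _ _ _))//.
  apply: (@le_trans _ _ (\sum_k `|A i k| * r ^+ l)).
    by apply: ler_sum => k _; rewrite normrM ler_wpM2l.
  rewrite -mulr_suml ler_wpM2r ?exprn_ge0// /r [leRHS](bigD1 i)//= lerDl.
  by apply: sumr_ge0 => k _; apply: sumr_ge0.
have rE : r = (Re r)%:C by rewrite (complexE r) (ger0_Im r0) mulr0 addr0.
exists (Re r) => l i j; rewrite mul1r; move: (Ar l i j); rewrite rE -rmorphXn.
move=> Al; split; rewrite -lecR; apply: le_trans Al.
  exact: normc_ge_Re.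
rewrite normc_def lecR -sqrtr_sqr ler_wsqrtr// lerDr sqr_ge0 //.
Qed.

Definition mxexp_sum A t (m : nat) : 'M[C]_n.+1 :=
  \sum_(l < m) ((t ^+ l / (l`!)%:R)%:C *: A ^+ l).

(** The left factor [B] covers both the exponential series ([B = 1]) and its derivative series
    ([B = A]). *)
Lemma mxexp_sum_Re A B t m i j : Re ((B *m mxexp_sum A t m) i j) =
  pseries (fun l => Re ((B *m A ^+ l) i j) / l`!%:R) t m.
Proof.
rewrite /pseries /series /= big_mkord mulmx_sumr summxE complex_Re_sum.
apply: eq_bigr => l _; rewrite -scalemxAr mxE complex_ReM /= mul0r subr0.
by rewrite mulrC mulrA mulrAC.
Qed.

Lemma mxexp_sum_Im A B t m i j : Im ((B *m mxexp_sum A t m) i j) =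
  pseries (fun l => Im ((B *m A ^+ l) i j) / l`!%:R) t m.
Proof.
rewrite /pseries /series /= big_mkord mulmx_sumr summxE complex_Im_sum.
apply: eq_bigr => l _; rewrite -scalemxAr mxE complex_ImM /= mul0r addr0.
by rewrite mulrC mulrA mulrAC.
Qed.

Lemma mxexp_sum_cvg A t i j :
  (fun m => Re (mxexp_sum A t m i j)) @ \oo -->
    limn (pseries (fun l => Re ((A ^+ l) i j) / l`!%:R) t) /\
  (fun m => Im (mxexp_sum A t m i j)) @ \oo -->
    limn (pseries (fun l => Im ((A ^+ l) i j) / l`!%:R) t).
Proof.
have [r Ar] := mxpow_bound A; split.
  under eq_fun do rewrite -[mxexp_sum _ _ _]mul1mx mxexp_sum_Re.
  under [X in limn (pseries X _)]eq_fun do rewrite -[A ^+ _]mul1mx.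
  apply: (@cvg_pseries_fact _ _ 1 r) => l.
  by case: (Ar l i j) => + _; rewrite mul1mx.
under eq_fun do rewrite -[mxexp_sum _ _ _]mul1mx mxexp_sum_Im.
under [X in limn (pseries X _)]eq_fun do rewrite -[A ^+ _]mul1mx.
apply: (@cvg_pseries_fact _ _ 1 r) => l.
by case: (Ar l i j) => _; rewrite mul1mx.
Qed.

Lemma mxexpE A t i j : mxexp A t i j =
  limn (pseries (fun l => Re ((A ^+ l) i j) / l`!%:R) t) +i*
  limn (pseries (fun l => Im ((A ^+ l) i j) / l`!%:R) t).
Proof.
by rewrite mxE; have [cR cI] := mxexp_sum_cvg A t i j; exact: lim_complex.
Qed.

Lemma mxexp_cvg A t i j :
  (fun m => Re (mxexp_sum A t m i j)) @ \oo --> Re (mxexp A t i j) /\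
  (fun m => Im (mxexp_sum A t m i j)) @ \oo --> Im (mxexp A t i j).
Proof. by rewrite mxexpE; exact: mxexp_sum_cvg. Qed.

Lemma mulmx_mxexp_cvg A B t i j :
  (fun m => Re ((B *m mxexp_sum A t m) i j)) @ \oo
    --> Re ((B *m mxexp A t) i j) /\
  (fun m => Im ((B *m mxexp_sum A t m) i j)) @ \oo
    --> Im ((B *m mxexp A t) i j).
Proof.
split; rewrite mxE ?complex_Re_sum ?complex_Im_sum.
  under eq_fun do rewrite mxE complex_Re_sum.
  apply: cvg_big => [|k _]; first exact: add_continuous.
   have [cR cI] := mxexp_cvg A t k j.
  under eq_fun do rewrite complex_ReM; rewrite complex_ReM.
  by apply: cvgB; apply: cvgMl_tmp.
under eq_fun do rewrite mxE complex_Im_sum.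
apply: cvg_big => [|k _]; first exact: add_continuous.
   have [cR cI] := mxexp_cvg A t k j.
under eq_fun do rewrite complex_ImM; rewrite complex_ImM.
by apply: cvgD; apply: cvgMl_tmp.
Qed.

Lemma mxexp_cderive A t i j :
  is_cderive t (fun s => mxexp A s i j) ((A *m mxexp A t) i j).
Proof.
have [r Ar] := mxpow_bound A; have [cR cI] := mulmx_mxexp_cvg A A t i j.
have AS l : A *m A ^+ l = A ^+ l.+1 by rewrite exprS.
split.
  under eq_fun do rewrite mxexpE /=.
  (* The target is read as the limit of [A] times the partial sums, whose coefficients are the
     shifted powers produced by termwise differentiation. *)
  rewrite -(cvg_lim (@Rhausdorff R) cR).
  under [X in lim (X @ _)]eq_fun do rewrite mxexp_sum_Re.
  under [X in pseries X t]eq_fun do rewrite AS.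
  by apply: is_derive_pseries_fact => l; case: (Ar l i j) => + _; exact.
under eq_fun do rewrite mxexpE /=.
rewrite -(cvg_lim (@Rhausdorff R) cI).
under [X in lim (X @ _)]eq_fun do rewrite mxexp_sum_Im.
under [X in pseries X t]eq_fun do rewrite AS.
by apply: is_derive_pseries_fact => l; case: (Ar l i j) => _; exact.
Qed.

Lemma mxexp0 A : mxexp A 0 = 1%:M.
Proof.
have p0 (a : nat -> R) : limn (pseries a 0) = a 0%N.
  (* At [0], every nonempty partial sum equals its first term. *)
  apply: lim_near_cst => //; near=> m.
  rewrite /pseries /series /= -[m]prednK; last by near: m; exact: nbhs_infty_gt.
  rewrite big_nat_recl//= expr0 mulr1 big1 ?addr0// => k _.
  by rewrite exprS mul0r mulr0.
apply/matrixP => i j; rewrite mxexpE !p0 fact0 !divr1 expr0.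
by case: (_ i j).
Unshelve. all: by end_near.
Qed.

Lemma mulmx_mxexp_cderive A m (G : 'M[C]_(m, n.+1)) (Y : 'cV[C]_n.+1) t i :
  is_cderive t (fun s => (G *m (mxexp A s *m Y)) i 0)
    ((G *m (A *m (mxexp A t *m Y))) i 0).
Proof.
rewrite mxE; under eq_fun do rewrite mxE.
apply: is_cderive_sum => j; apply: is_cderiveMl.
rewrite mulmxA mxE; under eq_fun do rewrite mxE.
apply: is_cderive_sum => l.
under eq_fun do rewrite mulrC; rewrite mulrC; apply: is_cderiveMl.
exact: mxexp_cderive.
Qed.

(** Gronwall argument: the hypothesis makes [phi], the form [V] weighted by [expR (c * s)],
    nonincreasing along [y s]. Two matrices [G] and [K] allow a non-hermitian form, such as the
    energy with its multiplier term. *)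
Lemma lyapunov_mxexp A m (G K : 'M[C]_(m, n.+1)) (c : R) :
  let V (Y Z : 'cV[C]_n.+1) :=
    Re (\sum_(i < m) (G *m Y) i 0 * ((K *m Z) i 0)^*) in
  (forall Y, V (A *m Y) Y + V Y (A *m Y) <= - c * V Y Y) ->
  forall t Y, 0 <= t ->
    V (mxexp A t *m Y) (mxexp A t *m Y) <= expR (- (c * t)) * V Y Y.
Proof.
move=> V dV t Y t0; pose y s := mxexp A s *m Y.
have dVy (s : R) : is_derive s (1 : R) (fun u : R => V (y u) (y u))
    (V (A *m y s) (y s) + V (y s) (A *m y s)).
  rewrite /V -complex_ReD -big_split /=.
  have [] // : is_cderive s (fun u => \sum_(i < m)
      (G *m y u) i 0 * ((K *m y u) i 0)^*)
    (\sum_(i < m) ((G *m (A *m y s)) i 0 * ((K *m y s) i 0)^* +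
      (G *m y s) i 0 * ((K *m (A *m y s)) i 0)^*)).
  apply: is_cderive_sum => i; apply: is_cderiveM.
    exact: mulmx_mxexp_cderive.
  by apply: is_cderiveJ; exact: mulmx_mxexp_cderive.
pose phi (s : R) : R := expR (c * s) * V (y s) (y s).
have dphi (s : R) : is_derive s (1 : R) phi (expR (c * s) *
    (c * V (y s) (y s) + (V (A *m y s) (y s) + V (y s) (A *m y s)))).
  apply: is_derive_eq; rewrite /GRing.scale /=; ring.
suff : phi t <= phi 0.
  rewrite /phi mulr0 expR0 mul1r {3 4}/y mxexp0 mul1mx => phi_le.
  by rewrite expRN mulrC ler_pdivlMr ?expR_gt0// mulrC.
apply: (@ler0_derive1_nincry _ phi 0) => // [s _|].
- rewrite derive1E derive_val pmulr_rle0 ?expR_gt0//.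
  by have := dV (y s); lra.
- apply: derivable_within_continuous => s _; exact: ex_derive.
Qed.

End MatrixExponential.

(** * Multiplier identities for the scheme *)

Section Cells.
Variable R : realType.
Local Notation C := R[i].
Local Notation Re := complex.Re.
Local Notation Im := complex.Im.

Definition sqmod (x : C) : R := Re x ^+ 2 + Im x ^+ 2.

Lemma sqmod_ge0 x : 0 <= sqmod x.
Proof. by rewrite addr_ge0 ?sqr_ge0. Qed.

Variables (h : R) (y0 y1 z0 z1 e g : C).
Hypothesis h0 : h != 0.
Hypothesis yE : e + e = y0 + y1.
Hypothesis zE : h%:C * (z0 + z1) = (y1 - y0) + (y1 - y0).
Hypothesis gE : h%:C * g = 'i * (z0 - z1).

(** By the discrete product rule, the difference of [z conj y] is [(z1 - z0) conj e] plus avg [z]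
    times [conj (y1 - y0)]. By [zE] the latter is [|y1 - y0|^2 / h], which is real and drops out of
    [Im]. *)
Lemma cell_energy : h * Re (g * e^* + e * g^*) =
  2 * Im (z1 * y1^*) - 2 * Im (z0 * y0^*).
Proof.
move: yE zE gE.
case: y0 y1 z0 z1 => [y0r y0i] [y1r y1i] [z0r z0i] [z1r z1i].
case: e g => [er ei] [gr gi].
rewrite /= => -[eR eI] [zR zI] [gR gI].
have -> : y0r = er + er - y1r by rewrite eR; ring.
have -> : y0i = ei + ei - y1i by rewrite eI; ring.
have grE : gr = (z1i - z0i) / h.
  apply: (mulfI h0); transitivity (z1i - z0i); [lra | by field].
have giE : gi = (z0r - z1r) / h.
  apply: (mulfI h0); transitivity (z0r - z1r); [lra | by field].
(* Since [y0 = 2 e - y1], [zE] reads [z0 + z1 = 4 (y1 - e) / h]. *)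
have z0rE : z0r = (y1r - er) * 4 / h - z1r.
  apply: (mulfI h0); transitivity ((y1r - er) * 4 - h * z1r); [lra | by field].
have z0iE : z0i = (y1i - ei) * 4 / h - z1i.
  apply: (mulfI h0); transitivity ((y1i - ei) * 4 - h * z1i); [lra | by field].
by rewrite grE giE z0rE z0iE; field.
Qed.

Variables (x : R) (f Q0 Q1 q qd : C).
Hypothesis QE : Q1 - Q0 = h%:C * e.
Hypothesis qE : q + q = Q0 + Q1.
Hypothesis qdE : qd + qd = (f + f) - 'i * (z0 + z1).

(* Boundary term [x Im(Q conj Q_t) - x |y|^2 - Re(y conj Q)] of the continuous
   integration by parts; the [h ^+ 2] correction comes from the product rule
   avg(a b) = avg a * avg b + h^2/4 * (diff a) * (diff b). *)
Let T (s : R) (y z Q : C) : R :=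
  s * Im (Q * (f - 'i * z)^*) - s * sqmod y - Re (y * Q^*)
  - h ^+ 2 / 4 * Re (z * y^*).

(** Here [x] is the left node and [x + h / 2] the midpoint. Integrating by parts the terms in
    [Q conj z] and [x y conj z] yields [|e|^2] once each, hence the factor 2. The discretization
    leaves [h / 2 * |y1 - y0|^2], which is nonnegative when [h > 0]. *)
Lemma cell_multiplier :
  h * ((x + h / 2) * Im (q * g^* + qd * e^*)) =
    T (x + h) y1 z1 Q1 - T x y0 z0 Q0
    + 2 * h * sqmod e + h / 2 * sqmod (y1 - y0)
    + h * (2 * (x + h / 2) * Im (f * e^*) + Im (f * q^*)).
Proof.
rewrite /T /sqmod; move: yE zE gE QE qE qdE.
case: y0 y1 z0 z1 => [y0r y0i] [y1r y1i] [z0r z0i] [z1r z1i].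
case: e g => [er ei] [gr gi].
case: f Q0 Q1 q qd => [fr fi] [Q0r Q0i] [Q1r Q1i] [qr qi] [pr pim].
rewrite /= => -[eR eI] [zR zI] [gR gI] [QR QI] [qR qI] [pR pI].
have -> : y0r = er + er - y1r by rewrite eR; ring.
have -> : y0i = ei + ei - y1i by rewrite eI; ring.
have grE : gr = (z1i - z0i) / h.
  apply: (mulfI h0); transitivity (z1i - z0i); [lra | by field].
have giE : gi = (z0r - z1r) / h.
  apply: (mulfI h0); transitivity (z0r - z1r); [lra | by field].
have z0rE : z0r = (y1r - er) * 4 / h - z1r.
  apply: (mulfI h0); transitivity ((y1r - er) * 4 - h * z1r); [lra | by field].
have z0iE : z0i = (y1i - ei) * 4 / h - z1i.
  apply: (mulfI h0); transitivity ((y1i - ei) * 4 - h * z1i); [lra | by field].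
have -> : Q0r = Q1r - h * er by lra.
have -> : Q0i = Q1i - h * ei by lra.
have -> : qr = Q1r - h * er / 2 by lra.
have -> : qi = Q1i - h * ei / 2 by lra.
have -> : pr = fr + (z0i + z1i) / 2 by lra.
have -> : pim = fi - (z0r + z1r) / 2 by lra.
by rewrite grE giE z0rE z0iE; field.
Qed.

End Cells.

(** * Summation of the cell identities over the mesh *)

Section Multiplier.
Variable R : realType.
Local Notation C := R[i].
Local Notation Re := complex.Re.
Local Notation Im := complex.Im.

(** Cauchy-Schwarz against a constant sequence, from nonnegativity of the variance around the mean
    [m]. *)
Lemma sqr_sum_le (n : nat) (a : 'I_n -> R) :
  (\sum_i a i) ^+ 2 <= n%:R * \sum_i a i ^+ 2.
Proof.
case: n a => [a|n a]; first by rewrite !big_ord0 expr0n mulr0.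
set s := \sum_i a i; have n0 : 0 < n.+1%:R :> R by rewrite ltr0n.
pose m := s / n.+1%:R; have mE : n.+1%:R * m = s by rewrite mulrC divfK ?gt_eqF.
have : 0 <= \sum_i (a i - m) ^+ 2 by apply: sumr_ge0 => i _; exact: sqr_ge0.
under eq_bigr do rewrite sqrrB.
rewrite big_split sumrB /= sumrMnl -mulr_suml -/s sumr_const card_ord.
rewrite -[m ^+ 2 *+ _]mulr_natl => /(mulr_ge0 (ltW n0)); rewrite mulrDr mulrBr.
have -> : n.+1%:R * (n.+1%:R * m ^+ 2) = s ^+ 2 by rewrite -mE; ring.
have -> : n.+1%:R * (s * m *+ 2) = s ^+ 2 *+ 2 by rewrite -mE; ring.
lra.
Qed.

Lemma telescope_ord (n : nat) (T : nat -> R) :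
  \sum_(i < n) (T i.+1 - T i) = T n - T 0%N.
Proof.
by rewrite -(big_mkord xpredT (fun i => T i.+1 - T i)) telescope_sumr.
Qed.

Variables (n : nat) (h k : R) (y z Q : nat -> C) (e g q qd : 'I_n -> C).
Hypothesis h0 : 0 < h.
Hypothesis nh : n%:R * h = 1.
Hypothesis y0E : y 0%N = 0.
Hypothesis znE : z n = - 'i * k%:C * y n.
Hypothesis QnE : Q n = 0.
Hypothesis yE : forall i, e i + e i = y i + y i.+1.
Hypothesis zE : forall i : 'I_n,
  h%:C * (z i + z i.+1) = (y i.+1 - y i) + (y i.+1 - y i).
Hypothesis gE : forall i, h%:C * g i = 'i * (z i - z i.+1).
Hypothesis QE : forall i : 'I_n, Q i.+1 - Q i = h%:C * e i.
Hypothesis qE : forall i, q i + q i = Q i + Q i.+1.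
Hypothesis qdE : forall i,
  qd i + qd i = (k%:C * y n + k%:C * y n) - 'i * (z i + z i.+1).

Let E : R := h * \sum_i sqmod (e i).
Let xm (i : nat) : R := i%:R * h + h / 2.

Hypothesis q_le : forall i, sqmod (q i) <= E.

(** The cell identities telescope: [y 0 = 0] kills the left end, and [z n = - i k y n] gives
    [Im (z conj y) = - k |y|^2] at the right end. *)
Lemma energy_dissipation :
  h * \sum_i Re (g i * (e i)^* + e i * (g i)^*) = - 2 * k * sqmod (y n).
Proof.
rewrite mulr_sumr.
under eq_bigr => i _ do
  rewrite (cell_energy (lt0r_neq0 h0) (yE i) (zE i) (gE i)).
rewrite (telescope_ord n (fun i => 2 * Im (z i * (y i)^*))).
rewrite y0E znE /sqmod; case: (y n) (z 0%N) => [a b] [c d] /=; ring.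
Qed.

Lemma midpoint_bounds (i : 'I_n) : 0 <= xm i <= 1.
Proof.
have ih : 0 <= i%:R * h by rewrite mulr_ge0// ltW.
have : i.+1%:R * h <= n%:R * h by rewrite ler_wpM2r ?ler_nat// ltW.
rewrite nh -natr1 mulrDl mul1r /xm; move: (i%:R * h) ih => a a0 a1.
by have hp := h0; apply/andP; split; lra.
Qed.

Lemma sum_const_h (a : R) : h * \sum_(i < n) a = a.
Proof.
by rewrite sumr_const card_ord -mulr_natl mulrA [h * _]mulrC nh mul1r.
Qed.

(** Each cell is bounded by the mean of [|q|^2 <= E] and [|e|^2], with weight at most 1; since
    [n h = 1], the sum is at most [(E + E) / 2]. *)
Lemma multiplier_bound : `|h * \sum_(i < n) xm i * Im (q i * (e i)^*)| <= E.
Proof.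
have cell (i : 'I_n) : `|xm i * Im (q i * (e i)^*)| <= (E + sqmod (e i)) / 2.
  have /andP[x0 x1] := midpoint_bounds i; rewrite normrM ger0_norm//.
  rewrite -[leRHS]mul1r ler_pM//.
  apply: (@le_trans _ _ ((sqmod (q i) + sqmod (e i)) / 2)).
    case: (q i) (e i) => [a b] [c d]; rewrite /sqmod /= ler_norml.
    have := sqr_ge0 (a + d); have := sqr_ge0 (a - d).
    have := sqr_ge0 (b + c); have := sqr_ge0 (b - c); rewrite !expr2.
    by move=> *; apply/andP; split; nra.
  by rewrite ler_pM2r// lerD2r.
rewrite normrM gtr0_norm//.
apply: (@le_trans _ _ (h * \sum_i (E + sqmod (e i)) / 2)).
  rewrite ler_pM2l// (le_trans (ler_norm_sum _ _ _))//.
  by apply: ler_sum => i _; exact: cell.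
rewrite -mulr_suml big_split /= mulrA mulrDr sum_const_h -/E.
by lra.
Qed.

(** Telescoping gives [2 E - |y n|^2] plus a nonnegative error and terms in [f = k y n]. Young's
    inequality charges the latter [E / 2] against [e], [E / 2] against [q], and [(2 + 1/2) |f|^2],
    which explains [5 / 2 * k ^+ 2]. *)
Lemma multiplier_derivative :
  E - (1 + 5 / 2 * k ^+ 2) * sqmod (y n) <=
  h * \sum_(i < n) xm i * Im (q i * (g i)^* + qd i * (e i)^*).
Proof.
pose f := k%:C * y n.
have fE : sqmod f = k ^+ 2 * sqmod (y n).
  by rewrite /f /sqmod; case: (y n) => a b /=; ring.
pose T i : R := i%:R * h * Im (Q i * (f - 'i * z i)^*) - i%:R * h * sqmod (y i)
  - Re (y i * (Q i)^*) - h ^+ 2 / 4 * Re (z i * (y i)^*).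
have T0 : T 0%N = 0.
  rewrite /T y0E /sqmod; move: (f - _) => [p r].
  by case: (z 0%N) (Q 0%N) => [a b] [c d] /=; ring.
(* [Q n = 0] removes two terms, and the [h ^+ 2] correction vanishes because [z conj y] is purely
   imaginary at the right end. *)
have Tn : T n = - sqmod (y n).
  rewrite /T nh QnE /sqmod; move: (f - _) => [p r]; rewrite znE.
  by case: (y n) => a b /=; ring.
have cell (i : 'I_n) : T i.+1 - T i + h * (3 / 2 * sqmod (e i))
    - h * (5 / 2 * sqmod f + E / 2) <=
    h * (xm i * Im (q i * (g i)^* + qd i * (e i)^*)).
  have xS : i.+1%:R * h = i%:R * h + h by rewrite -natr1 mulrDl mul1r.
  rewrite (cell_multiplier (lt0r_neq0 h0) (yE i) (zE i) (gE i)
    (i%:R * h) (QE i) (qE i) (qdE i)) -xS -/f -/(T i.+1) -/(T i) -/(xm i).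
  have dy0 := sqmod_ge0 (y i.+1 - y i).
  have /andP[x0 x1] := midpoint_bounds i.
  have fe : - (2 * sqmod f + sqmod (e i) / 2) <= 2 * xm i * Im (f * (e i)^*).
    move: x0 x1; rewrite /sqmod; case: (f) (e i) => [a b] [c d] /=.
    move: (xm i) => w w0 w1.
    have : 0 <= w * w <= 1 by apply/andP; split; nra.
    (* The slack is [((2wb + c)^2 + (2wa - d)^2) / 2 + 2 (1 - w^2) (a^2 + b^2)]. *)
    have := sqr_ge0 (2 * w * b + c); have := sqr_ge0 (2 * w * a - d).
    have := sqr_ge0 a; have := sqr_ge0 b; rewrite !expr2.
    move=> a2 b2 h1 h2 /andP[w2 w3]; nra.
  have fq : - (sqmod f / 2 + E / 2) <= Im (f * (q i)^*).
    apply: le_trans (_ : - (sqmod f / 2 + sqmod (q i) / 2) <= _).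
      by have := q_le i; lra.
    rewrite /sqmod; case: (f) (q i) => [a b] [c d] /=.
    have := sqr_ge0 (a - d); have := sqr_ge0 (b + c); rewrite !expr2.
    by move=> ? ?; nra.
  have : 0 <= h * (sqmod (y i.+1 - y i) / 2 +
      (2 * xm i * Im (f * (e i)^*) + (2 * sqmod f + sqmod (e i) / 2)) +
      (Im (f * (q i)^*) + (sqmod f / 2 + E / 2))).
    by rewrite mulr_ge0 ?(ltW h0)//; lra.
  move: (T i.+1) (T i) (Im (f * (e i)^*)) (Im (f * (q i)^*)) => T1 T2 a b.
  move: (sqmod _) (sqmod _) (sqmod _) (xm i) E => c d s x E' H; lra.
rewrite mulr_sumr; apply: le_trans (ler_sum _ (fun i _ => cell i)).
rewrite sumrB big_split /= telescope_ord T0 Tn -!mulr_sumr sum_const_h.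
rewrite [h * (3 / 2 * _)]mulrCA -/E fE; lra.
Qed.

End Multiplier.

(** * The scheme in matrix form *)

Section Scheme.
Variables (R : realType) (N : nat).
Local Notation C := R[i].
Local Notation Re := complex.Re.
Local Notation Im := complex.Im.
Local Notation n := N.+1.
Local Notation h := (hN R N).

Let addE (A B : 'cV[C]_n) i : (A + B) i 0 = A i 0 + B i 0.
Proof. by rewrite mxE. Qed.

Let oppE (A : 'cV[C]_n) i : (- A) i 0 = - A i 0.
Proof. by rewrite mxE. Qed.

Let scaleE a (A : 'cV[C]_n) i : (a *: A) i 0 = a * A i 0.
Proof. by rewrite mxE. Qed.

Lemma hN_gt0 : 0 < h. Proof. by rewrite invr_gt0 ltr0n. Qed.

Lemma hN_inv : n%:R * h = 1. Proof. by rewrite mulfV// pnatr_eq0. Qed.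

Lemma Dh_unit : Dh R N \in unitmx.
Proof.
rewrite unitmxE det_trig; last first.
  apply/is_trig_mxP => i j ij; rewrite mxE.
  by rewrite -val_eqE /= (ltn_eqF ij) (ltn_eqF (ltnW _)).
rewrite unitfE; apply/prodf_neq0 => i _; rewrite mxE eqxx /=.
by rewrite fmorph_eq0 invr_eq0 pnatr_eq0.
Qed.

(** Component [i] of [Y] sits at node [i + 1]; the condition [w(0) = 0] supplies node [0]. *)
Definition node (Y : 'cV[C]_n) (j : nat) : C :=
  if j is j'.+1 then Y (inord j') 0 else 0.

(** The components of [Z] sit at nodes [0] to [n - 1], and [b] is appended at node [n]: [0] for bare
    matrix products, [- i k y_n] for the flux. *)
Definition dual_node (Z : 'cV[C]_n) (b : C) (j : nat) : C :=
  if (j < n)%N then Z (inord j) 0 else b.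

Lemma nodeS (Y : 'cV[C]_n) (i : 'I_n) : node Y i.+1 = Y i 0.
Proof. by rewrite /node inord_val. Qed.

Lemma node_max (Y : 'cV[C]_n) : node Y n = Y ord_max 0.
Proof. by rewrite -(nodeS Y ord_max). Qed.

Lemma dual_nodeE (Z : 'cV[C]_n) b (i : 'I_n) : dual_node Z b i = Z i 0.
Proof. by rewrite /dual_node ltn_ord inord_val. Qed.

Lemma dual_node_max (Z : 'cV[C]_n) b : dual_node Z b n = b.
Proof. by rewrite /dual_node ltnn. Qed.

Lemma sum_pred_node (Y : 'cV[C]_n) (i : 'I_n) (a : C) :
  \sum_j (if nat_of_ord i == (nat_of_ord j).+1 then a * Y j 0 else 0) =
  a * node Y i.
Proof.
rewrite -big_mkcond; case: i => [[|i] lti] /=; first by rewrite big1 ?mulr0.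
have lti' : (i < n)%N by exact: ltnW.
rewrite (big_pred1 (Ordinal lti')) /node.
  by congr (a * Y _ 0); apply/val_inj; rewrite /= inordK.
by move=> j; rewrite /= eqSS eq_sym.
Qed.

Lemma sum_succ_node (Z : 'cV[C]_n) (i : 'I_n) (a : C) :
  \sum_j (if nat_of_ord j == (nat_of_ord i).+1 then a * Z j 0 else 0) =
  a * dual_node Z 0 i.+1.
Proof.
rewrite -big_mkcond /dual_node; case: ltnP => [lti|lein].
  rewrite (big_pred1 (inord i.+1))// => j.
  by rewrite /= -val_eqE /= inordK.
rewrite mulr0 big1// => j /eqP ji; have := ltn_ord j.
by rewrite ji ltnNge lein.
Qed.

Lemma sum_eq_node (Y : 'cV[C]_n) (i : 'I_n) (a : C) :
  \sum_j (if i == j then a * Y j 0 else 0) = a * Y i 0.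
Proof. by rewrite -big_mkcond (big_pred1 i)// => j; rewrite /= eq_sym. Qed.

Lemma Dh_mulmx (Y : 'cV[C]_n) i :
  (Dh R N *m Y) i 0 + (Dh R N *m Y) i 0 = node Y i + node Y i.+1.
Proof.
have -> : (Dh R N *m Y) i 0 =
    (2^-1)%:C * Y i 0 + (2^-1)%:C * node Y i.
  rewrite mxE -sum_eq_node -sum_pred_node -big_split; apply: eq_bigr => j _ /=.
  rewrite mxE; case: eqVneq => [<-|_] /=; last first.
    by case: eqP; rewrite ?mul0r add0r.
  by rewrite -[_ == _.+1]negbK neq_ltn ltnSn addr0.
rewrite nodeS; case: (Y i 0) (node Y i) => [a b] [c d].
by apply/eqP; rewrite eq_complex /=; apply/andP; split; apply/eqP; field.
Qed.

Lemma trDh_mulmx (Z : 'cV[C]_n) i :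
  ((Dh R N)^T *m Z) i 0 = (2^-1)%:C * (Z i 0 + dual_node Z 0 i.+1).
Proof.
rewrite mxE mulrDr -sum_eq_node -sum_succ_node -big_split.
apply: eq_bigr => j _.
rewrite !mxE [j == i]eq_sym /=; case: eqVneq => [<-|_] /=; last first.
  by case: eqP; rewrite ?mul0r add0r.
by rewrite -[_ == _.+1]negbK neq_ltn ltnSn addr0.
Qed.

Lemma Mh_mulmx (Z : 'cV[C]_n) i :
  (Mh R N *m Z) i 0 = (h^-1)%:C * (dual_node Z 0 i.+1 - Z i 0).
Proof.
rewrite mxE mulrBr addrC -mulNr -rmorphN -sum_eq_node -sum_succ_node -big_split.
apply: eq_bigr => j _; rewrite mxE /=; case: eqVneq => [<-|_] /=.
  by rewrite -[_ == _.+1]negbK neq_ltn ltnSn addr0.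
by case: eqP; rewrite ?mul0r add0r.
Qed.

Lemma trMh_mulmx (Y : 'cV[C]_n) i :
  ((Mh R N)^T *m Y) i 0 = (h^-1)%:C * (node Y i - node Y i.+1).
Proof.
rewrite nodeS mxE mulrBr addrC -mulNr -rmorphN -sum_eq_node -sum_pred_node.
rewrite -big_split; apply: eq_bigr => j _.
rewrite !mxE [j == i]eq_sym /=; case: eqVneq => [<-|_] /=.
  by rewrite -[_ == _.+1]negbK neq_ltn ltnSn addr0.
by case: eqP; rewrite ?mul0r add0r.
Qed.

Lemma Eh_mulmx (Y : 'cV[C]_n) i :
  (Eh R N *m Y) i 0 = if i == ord_max then node Y n else 0.
Proof.
rewrite node_max mxE (bigD1 ord_max)//= mxE eqxx andbT big1 ?addr0.
  by case: eqP; rewrite ?mul1r ?mul0r.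
by move=> j /negbTE jm; rewrite mxE jm andbF mul0r.
Qed.

Definition flux (k : R) : 'M[C]_n :=
  invmx (Dh R N)^T *m (- (Mh R N)^T + ('i * (k / 2)%:C) *: Eh R N).

Definition flux_node (k : R) (Y : 'cV[C]_n) : nat -> C :=
  dual_node (flux k *m Y) (- 'i * k%:C * node Y n).

Lemma flux_node_max k Y : flux_node k Y n = - 'i * k%:C * node Y n.
Proof. exact: dual_node_max. Qed.

Lemma ord_maxVlt (i : 'I_n) : i = ord_max \/ (i.+1 < n)%N.
Proof.
have [iN|] := ltnP i.+1 n; [by right | left; apply/val_inj => /=].
by apply/eqP; rewrite eqn_leq -ltnS ltn_ord.
Qed.

(* The dual value at the right end is [- i k y_n]; in the matrices it is
   replaced by [0], the boundary condition being carried by [Eh]. *)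
Lemma flux_nodeS k Y (i : 'I_n) : flux_node k Y i.+1 =
  dual_node (flux k *m Y) 0 i.+1
  - 'i * k%:C * (if i == ord_max then node Y n else 0).
Proof.
rewrite /flux_node; have [->|iN] := ord_maxVlt i.
  by rewrite eqxx !dual_node_max add0r !mulNr.
by rewrite /dual_node iN ifN ?mulr0 ?subr0// -val_eqE /= neq_ltn -ltnS iN.
Qed.

(** In the last row the transpose of [Dh] omits [z_n / 2]; the term [(i k / 2) y_n] on the
    right-hand side is exactly [- z_n / 2]. *)
Lemma flux_nodeE k Y (i : 'I_n) :
  h%:C * (flux_node k Y i + flux_node k Y i.+1) =
  (node Y i.+1 - node Y i) + (node Y i.+1 - node Y i).
Proof.
have h0 : h != 0 by rewrite gt_eqF ?hN_gt0.
have : ((Dh R N)^T *m (flux k *m Y)) i 0 =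
    ((- (Mh R N)^T + ('i * (k / 2)%:C) *: Eh R N) *m Y) i 0.
  by rewrite /flux !mulmxA mulmxV ?unitmx_tr ?Dh_unit// mul1mx.
rewrite trDh_mulmx mulmxDl mulNmx -scalemxAl addE oppE scaleE.
rewrite trMh_mulmx Eh_mulmx.
rewrite flux_nodeS /flux_node dual_nodeE.
move: (_ i 0) (dual_node _ 0 _) (node Y i) (node Y i.+1) (if _ then _ else _).
move: h h0 => d d0 [z0r z0i] [z1r z1i] [y0r y0i] [y1r y1i] [wr wi] /= [zR zI].
have zrE : z0r + z1r = - (2 * d^-1 * (y0r - y1r)) - k * wi.
  by move: zR; rewrite !(mul0r, mul1r, subr0, addr0, add0r, mulr0, sub0r); lra.
have ziE : z0i + z1i = - (2 * d^-1 * (y0i - y1i)) + k * wr.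
  by move: zI; rewrite !(mul0r, mul1r, subr0, addr0, add0r, mulr0, sub0r); lra.
apply/eqP; rewrite eq_complex /=; apply/andP; split; apply/eqP.
  have -> : z0r = - (2 * d^-1 * (y0r - y1r)) - k * wi - z1r by lra.
  by field.
have -> : z0i = - (2 * d^-1 * (y0i - y1i)) + k * wr - z1i by lra.
by field.
Qed.

(** Likewise [- (k / h) y_n] equals the contribution [- i z_n / h] missing from the last row of
    [- i M Z]. *)
Lemma Dh_Ah_mulmx k Y (i : 'I_n) : h%:C * (Dh R N *m (Ah k N *m Y)) i 0 =
  'i * (flux_node k Y i - flux_node k Y i.+1).
Proof.
have h0 : h != 0 by rewrite gt_eqF ?hN_gt0.
have -> : Dh R N *m (Ah k N *m Y) = - 'i *: (Mh R N *m (flux k *m Y))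
    - (k / h)%:C *: (Eh R N *m Y).
  rewrite /Ah mulmxA [Dh R N *m (invmx _ *m _)]mulmxA mulmxV ?Dh_unit//.
  rewrite mul1mx mulmxBl -!scalemxAl.
  by rewrite /flux !mulmxA.
rewrite addE oppE !scaleE Mh_mulmx Eh_mulmx flux_nodeS /flux_node dual_nodeE.
move: (_ i 0) (dual_node _ 0 _) (if _ then _ else _).
move: h h0 => d d0 [z0r z0i] [z1r z1i] [wr wi].
by apply/eqP; rewrite eq_complex /=; apply/andP; split; apply/eqP; field.
Qed.

(* Trapezoidal version of [u |-> - int_x^1 u]. *)
Definition primitive_mx : 'M[C]_n :=
  \matrix_(i, l) (- (h * ((i <= l)%:R + (i < l)%:R) / 2))%:C.

(** Downward induction from the right end. It identifies the time derivative of the primitive with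
    [k y_n - i z]. *)
Lemma primitive_unique (u : 'I_n -> C) (P Q : nat -> C) :
  P n = Q n ->
  (forall i : 'I_n, P i.+1 - P i = u i) ->
  (forall i : 'I_n, Q i.+1 - Q i = u i) ->
  forall j, (j <= n)%N -> P j = Q j.
Proof.
move=> PQn PE QE j jn; rewrite -(subKn jn).
elim: (n - j)%N (leq_subr j n) => [|d IH] dn; first by rewrite subn0.
have lt : (n - d.+1 < n)%N by rewrite ltn_subrL.
have Sd : (n - d.+1).+1 = (n - d)%N by rewrite subnSK.
have := PE (Ordinal lt); have := QE (Ordinal lt).
rewrite /= Sd (IH (ltnW dn)) => <- /(addrI _) /oppr_inj; exact.
Qed.

(** The nodal primitive [Q]; [primitive_mx] gives its cell averages. *)
Definition tail_sum (u : 'cV[C]_n) (j : nat) : C :=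
  - (h%:C * \sum_(l < n) (j <= l)%:R * u l 0).

Lemma tail_sum_max u : tail_sum u n = 0.
Proof.
rewrite /tail_sum big1 ?mulr0 ?oppr0// => l _.
by rewrite leqNgt ltn_ord mul0r.
Qed.

Lemma tail_sumB u (i : 'I_n) : tail_sum u i.+1 - tail_sum u i = h%:C * u i 0.
Proof.
rewrite /tail_sum opprK addrC -mulrBr -sumrB; congr (_ * _).
rewrite (bigD1 i)//= leqnn ltnn mul0r mul1r subr0 big1 ?addr0// => l li.
have il : (nat_of_ord i == l) = false by rewrite eq_sym; exact/negbTE.
by rewrite [(i <= l)%N]leq_eqVlt il subrr.
Qed.

Lemma primitive_mxE u (i : 'I_n) :
  (primitive_mx *m u) i 0 + (primitive_mx *m u) i 0 =
  tail_sum u i + tail_sum u i.+1.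
Proof.
rewrite /tail_sum -opprD -mulrDr -!big_split /= mxE.
rewrite mulr_sumr -sumrN -big_split; apply: eq_bigr => l _ /=; rewrite mxE.
case: (u l 0) => a b; case: (i <= l)%N; case: (i < l)%N;
  by apply/eqP; rewrite eq_complex /=; apply/andP; split; apply/eqP; field.
Qed.

(** Discrete Poincare inequality: the weights [w] lie in [[-1, 0]], so Cauchy-Schwarz and [n h = 1]
    give a constant independent of [h]. *)
Lemma sqmod_primitive (u : 'cV[C]_n) (i : 'I_n) :
  sqmod ((primitive_mx *m u) i 0) <= h * \sum_l sqmod (u l 0).
Proof.
pose w (l : 'I_n) : R := - (((i <= l)%:R + (i < l)%:R) / 2).
have w1 l : w l ^+ 2 <= 1.
  by rewrite /w; case: (_ <= _)%N; case: (_ < _)%N => /=; rewrite expr2; lra.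
have wsum (a : 'I_n -> R) :
    (\sum_l h * w l * a l) ^+ 2 <= h * \sum_l a l ^+ 2.
  under eq_bigr do rewrite -mulrA.
  rewrite -mulr_sumr exprMn.
  apply: (@le_trans _ _ (h ^+ 2 * (n%:R * \sum_l (w l * a l) ^+ 2))).
    by rewrite ler_wpM2l ?sqr_ge0// sqr_sum_le.
  rewrite mulrA [h ^+ 2 * _]mulrC expr2 mulrA hN_inv mul1r.
  rewrite ler_wpM2l ?(ltW hN_gt0)//; apply: ler_sum => l _.
  by rewrite exprMn ler_piMl ?sqr_ge0.
rewrite /sqmod mxE complex_Re_sum complex_Im_sum.
under eq_bigr => l _ do rewrite mxE complex_ReM /= mul0r subr0.
under [X in _ + X ^+ 2]eq_bigr => l _ do rewrite mxE complex_ImM /= mul0r addr0.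
rewrite big_split mulrDr lerD//.
  rewrite (eq_bigr (fun l => h * w l * Re (u l 0))) ?wsum// => l _.
  by rewrite /w mulrN mulrA.
rewrite (eq_bigr (fun l => h * w l * Im (u l 0))) ?wsum// => l _.
by rewrite /w mulrN mulrA.
Qed.

End Scheme.

(** * Lyapunov functional and uniform decay rate *)

Section Decay.
Variables (R : realType) (N : nat) (k : R).
Local Notation C := R[i].
Local Notation Re := complex.Re.
Local Notation Im := complex.Im.
Local Notation n := N.+1.
Local Notation h := (hN R N).
Local Notation D := (Dh R N).
Local Notation S := (primitive_mx R N).
Implicit Types Y Z : 'cV[C]_n.

Definition energy Y : R := h * \sum_i sqmod ((D *m Y) i 0).

Lemma energy_ge0 Y : 0 <= energy Y.
Proof.
by rewrite mulr_ge0 ?(ltW (hN_gt0 _ _))// sumr_ge0// => i _; exact: sqmod_ge0.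
Qed.

Lemma ynormE Y : ynorm N Y = Num.sqrt (energy Y).
Proof.
rewrite /ynorm /yinner complex_ReM /= mul0r subr0 complex_Re_sum.
congr (Num.sqrt (_ * _)); apply: eq_bigr => i _; rewrite /sqmod.
by case: ((D *m Y) i 0) => a b /=; ring.
Qed.

Local Notation mid i := (i%:R * h + h / 2).

(** Since [Re (i c) = - Im c], pairing this matrix with the identity encodes [E - eps F], up to the
    factor [h]. *)
Definition lyapunov_mx (eps : R) : 'M[C]_n :=
  \matrix_(i, l) ((i == l)%:R + 'i * (eps * mid i)%:C * S i l).

Lemma lyapunov_mxE eps (u : 'cV[C]_n) i :
  (lyapunov_mx eps *m u) i 0 =
  u i 0 + 'i * (eps * mid i)%:C * (S *m u) i 0.
Proof.
have {2}-> : u = 1%:M *m u by rewrite mul1mx.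
rewrite !mxE mulr_sumr -big_split.
by apply: eq_bigr => l _ /=; rewrite !mxE mulrDl mulrA.
Qed.

Definition lyapunov eps Y Z : R :=
  Re (\sum_(i < n) (lyapunov_mx eps *m D *m Y) i 0 * ((D *m Z) i 0)^*).

Lemma lyapunovE eps Y Z : lyapunov eps Y Z =
  \sum_i Re ((D *m Y) i 0 * ((D *m Z) i 0)^*)
  - eps * \sum_(i < n) mid i * Im ((S *m (D *m Y)) i 0 * ((D *m Z) i 0)^*).
Proof.
rewrite /lyapunov complex_Re_sum mulr_sumr -sumrB; apply: eq_bigr => i _.
rewrite -mulmxA lyapunov_mxE.
case: ((D *m Y) i 0) ((S *m _) i 0) ((D *m Z) i 0) => [a b] [c d] [p q] /=.
ring.
Qed.

Lemma lyapunov_diag eps Y : h * lyapunov eps Y Y = energy Y -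
  eps * (h * \sum_(i < n) mid i * Im ((S *m (D *m Y)) i 0 * ((D *m Y) i 0)^*)).
Proof.
rewrite lyapunovE mulrBr mulrCA; congr (_ * _ - _).
apply: eq_bigr => i _; rewrite /sqmod.
by case: ((D *m Y) i 0) => a b /=; ring.
Qed.

Lemma lyapunov_equiv eps Y : 0 <= eps <= 1 / 2 ->
  energy Y / 2 <= h * lyapunov eps Y Y <= 3 / 2 * energy Y.
Proof.
move=> /andP[e0 e1]; rewrite lyapunov_diag.
have := @multiplier_bound R n h _ _ (hN_gt0 R N) (hN_inv R N)
  (fun i => sqmod_primitive (D *m Y) i).
rewrite -/(energy Y) ler_norml; have := energy_ge0 Y.
move: (energy Y) (h * _) => E F E0 /andP[F1 F2].
apply/andP; split; nra.
Qed.

(** The second condition on [eps] lets the dissipation [2 k |y_n|^2] absorb the boundary loss of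
    [eps F']. What remains is [- eps E], and [V <= 3/2 E] turns it into the rate [2/3 eps]. *)
Lemma lyapunov_decay eps Y : 0 <= eps <= 1 / 2 ->
  eps * (1 + 5 / 2 * k ^+ 2) <= 2 * k ->
  lyapunov eps (Ah k N *m Y) Y + lyapunov eps Y (Ah k N *m Y) <=
  - (2 / 3 * eps) * lyapunov eps Y Y.
Proof.
move=> he epsk; rewrite -(ler_pM2l (hN_gt0 R N)) mulrCA.
have /andP[_ V_le] := lyapunov_equiv Y he.
pose A := Ah k N *m Y.
(* This is [Q' = k y_n - i z]: both sides have the same differences, and both vanish at node [n] by
   the boundary condition. *)
have tailA j : (j <= n)%N ->
    tail_sum (D *m A) j = k%:C * node Y n - 'i * flux_node k Y j.
  apply: (@primitive_unique _ _ (fun i => h%:C * (D *m A) i 0) _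
    (fun i => k%:C * node Y n - 'i * flux_node k Y i)) => [|i|i].
  - rewrite tail_sum_max flux_node_max.
    by case: (node Y n) => a b; apply/eqP; rewrite eq_complex /=;
      apply/andP; split; apply/eqP; ring.
  - exact: tail_sumB.
  - by rewrite Dh_Ah_mulmx; ring.
have zn := flux_node_max k Y.
have dE := energy_dissipation (hN_gt0 R N) (erefl : node Y 0 = 0) zn
  (Dh_mulmx Y) (flux_nodeE k Y) (Dh_Ah_mulmx k Y).
have qdE i : (S *m (D *m A)) i 0 + (S *m (D *m A)) i 0 =
    k%:C * node Y n + k%:C * node Y n
    - 'i * (flux_node k Y i + flux_node k Y i.+1).
  by rewrite primitive_mxE !tailA ?(ltnW (ltn_ord i))//; ring.
have dF := multiplier_derivative (hN_gt0 R N) (hN_inv R N)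
  (erefl : node Y 0 = 0) zn (tail_sum_max (D *m Y))
  (Dh_mulmx Y) (flux_nodeE k Y) (Dh_Ah_mulmx k Y) (tail_sumB (D *m Y))
  (primitive_mxE (D *m Y)) qdE (sqmod_primitive (D *m Y)).
have -> : h * (lyapunov eps A Y + lyapunov eps Y A) =
  h * (\sum_i Re ((D *m A) i 0 * ((D *m Y) i 0)^* +
                  (D *m Y) i 0 * ((D *m A) i 0)^*)) -
  eps * (h * \sum_(i < n) mid i * Im (
    (S *m (D *m Y)) i 0 * ((D *m A) i 0)^* +
    (S *m (D *m A)) i 0 * ((D *m Y) i 0)^*)).
  rewrite !lyapunovE.
  under [X in _ = h * X - _]eq_bigr do rewrite complex_ReD.
  under [X in _ = _ - eps * (h * X)]eq_bigr do rewrite complex_ImD mulrDr.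
  by rewrite !big_split /=; ring.
rewrite dE; move: dF V_le; rewrite -/(energy Y).
have := sqmod_ge0 (node Y n); have := energy_ge0 Y.
move: (energy Y) (h * lyapunov _ _ _) (h * _) (sqmod _).
move=> E V F s E0 s0 dF V_le.
have /andP[e0 e1] := he.
have h1 : eps * (E - (1 + 5 / 2 * k ^+ 2) * s) <= eps * F by rewrite ler_wpM2l.
have h2 : eps * (1 + 5 / 2 * k ^+ 2) * s <= 2 * k * s by rewrite ler_wpM2r.
have h3 : eps * V <= eps * (3 / 2 * E) by rewrite ler_wpM2l.
lra.
Qed.

(** The factor 3 is the ratio of the equivalence constants [3/2] and [1/2]. *)
Lemma energy_decay eps t Y : 0 <= eps <= 1 / 2 ->
  eps * (1 + 5 / 2 * k ^+ 2) <= 2 * k -> 0 <= t ->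
  energy (mxexp (Ah k N) t *m Y) <= 3 * expR (- (2 / 3 * eps * t)) * energy Y.
Proof.
move=> he epsk t0.
have := @lyapunov_mxexp R N (Ah k N) n (lyapunov_mx eps *m D) D (2 / 3 * eps)
  (fun Z => lyapunov_decay Z he epsk) t Y t0.
rewrite -/(lyapunov eps _ _) -/(lyapunov eps Y Y) -(ler_pM2l (hN_gt0 R N)).
rewrite mulrCA => decay.
have /andP[lo _] := lyapunov_equiv (mxexp (Ah k N) t *m Y) he.
have /andP[_ hi] := lyapunov_equiv Y he.
have hi' : expR (- (2 / 3 * eps * t)) * (h * lyapunov eps Y Y) <=
  expR (- (2 / 3 * eps * t)) * (3 / 2 * energy Y).
  by rewrite ler_wpM2l ?expR_ge0.
lra.
Qed.

End Decay.

(* ||T_h(t)|| <= M e^{-w t}, with ||.|| the operator norm induced by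
   <.,.>_{Y_h}, written out as: ||T_h(t) Y|| <= M e^{-w t} ||Y|| for all Y. *)
Theorem theorem3 (R : realType) (k : R) (hk : 0 < k) :
  exists M w : R, 0 < M /\ 0 < w /\
    forall N : nat, (0 < N)%N ->
    forall t : R, 0 <= t ->
    forall Y : 'cV[R[i]]_N.+1,
      ynorm N (mxexp (Ah k N) t *m Y) <= M * expR (- (w * t)) * ynorm N Y.
Proof.
pose c := 1 + 5 / 2 * k ^+ 2.
have c0 : 0 < c by rewrite ltr_pwDl// mulr_ge0 ?sqr_ge0.
(* The largest [eps] meeting both smallness conditions; it depends on [k] only. *)
pose eps := Num.min (1 / 2) (2 * k / c).
have eps0 : 0 < eps by rewrite lt_min !divr_gt0// mulr_gt0.
have epsle : 0 <= eps <= 1 / 2 by rewrite ltW//= ge_min lexx.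
have epsk : eps * c <= 2 * k by rewrite -ler_pdivlMr// ge_min lexx orbT.
(* The norm is the square root of the energy, so the constant 3 becomes its root and the rate
   [2/3 eps] is halved. *)
exists (Num.sqrt 3), (eps / 3); rewrite sqrtr_gt0 ltr0n divr_gt0//.
split=> //; split=> // N _ t t0 Y; rewrite !ynormE.
have -> : expR (- (eps / 3 * t)) = Num.sqrt (expR (- (2 / 3 * eps * t))).
  rewrite (_ : - (2 / 3 * eps * t) = - (eps / 3 * t) + - (eps / 3 * t)).
    by rewrite expRD -expr2 sqrtr_sqr ger0_norm ?expR_ge0.
  by field.
rewrite -!sqrtrM ?mulr_ge0 ?expR_ge0// ler_wsqrtr//.
exact: energy_decay.
Qed.
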